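(* Let $G$ be a regular Lie group with Lie algebra $\mathfrak g=\mathbf T_eG$. For all $X,Y\in\mathfrak g$ and all $d_1,d_2,d_3\in D$, $$\exp\big((d_1+d_2+d_3)(X+Y)\big)=\exp\big((d_1+d_2+d_3)X\big).\exp\big((d_1+d_2+d_3)Y\big).\exp\big(-(d_1d_2+d_1d_3+d_2d_3)[X,Y]\big).\exp\big(d_1d_2d_3[X+2Y,[X,Y]]\big)$$ $$=\exp\big((d_1+d_2+d_3)X\big).\exp\big((d_1+d_2+d_3)Y\big).\exp\Big(-\frac{(d_1+d_2+d_3)^2}{2}[X,Y]\Big).\exp\Big(\frac{(d_1+d_2+d_3)^3}{6}[X+2Y,[X,Y]]\Big).$$
   Context: We work in synthetic differential geometry. $\mathbb R$ is the line: a commutative ring in which positive integers are invertible, satisfying the (general) Kock-Lawvere axiom. $D=\{d\in\mathbb R\mid d^2=0\}$. A space $M$ is microlinear if every finite diagram of infinitesimal spaces that $\mathbb R$ perceives as a colimit is also perceived as a colimit by $M$. A Lie group is a group which is microlinear as a space; its unit is $e$ and its product is written with a dot. $\mathfrak g=\mathbf T_eG$ is the set of maps $X:D\to G$, $d\mapsto X_d$, with $X_0=e$; it is an $\mathbb R$-module with $(\alpha X)_d=X_{\alpha d}$ and $(X+Y)_d=X_d.Y_d=Y_d.X_d$, and a Lie algebra whose bracket $[X,Y]$ is the unique element of $\mathfrak g$ with $X_{d_1}.Y_{d_2}.X_{-d_1}.Y_{-d_2}=[X,Y]_{d_1d_2}$ for all $d_1,d_2\in D$. A Lie group $G$ is regular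 if for every map $\varsigma:\mathbb R\to\mathfrak g$ there is a map $\theta:\mathbb R\to G$ with $\theta(0)=e$ and $\theta(t+d)=\theta(t).\varsigma(t)_d$ for all $t\in\mathbb R$, $d\in D$. For $X\in\mathfrak g$, if $\theta:\mathbb R\to G$ is a one-parameter subgroup (a homomorphism from the additive group of $\mathbb R$) with $\theta(d)=X_d$ for all $d\in D$, then $\exp X$ denotes $\theta(1)$; when $G$ is regular, $\exp:\mathfrak g\to G$ is a total function. *)

(* Defs.v *)
#[warnings="-notation-overridden"]
From mathcomp Require Import all_boot.
From Stdlib Require Import Ring_theory.

Set Implicit Arguments.
Unset Strict Implicit.
Unset Printing Implicit Defensive.

(* Synthetic differential geometry is developed in the internal language:      *)
(* spaces are types, maps are functions, and "there is" is the intuitionistic  *)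
(* quantifier of Prop.  The algebraic structures of MathComp are built on      *)
(* choiceType, hence on decidable equality, which together with the            *)
(* Kock-Lawvere axiom forces the line to be the zero ring.  The line and the   *)
(* Lie groups therefore get bare algebraic structures here; MathComp is used   *)
(* only for finite index types and finite sums.                                *)

Declare Scope line_scope.
Delimit Scope line_scope with L.
Declare Scope tangent_scope.
Delimit Scope tangent_scope with tan.
Declare Scope lie_scope.
Delimit Scope lie_scope with lie.

Record cring := CRing {
  cring_sort :> Type;
  c0 : cring_sort;
  c1 : cring_sort;
  cadd : cring_sort -> cring_sort -> cring_sort;
  cmul : cring_sort -> cring_sort -> cring_sort;
  copp : cring_sort -> cring_sort;
  cringP : ring_theory c0 c1 cadd cmul (fun x y => cadd x (copp y)) copp eq
}.

Arguments c0 {_}.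
Arguments c1 {_}.
Arguments cadd {_} _ _.
Arguments cmul {_} _ _.
Arguments copp {_} _.

Bind Scope line_scope with cring_sort.
Notation "0" := c0 : line_scope.
Notation "1" := c1 : line_scope.
Notation "x + y" := (cadd x y) : line_scope.
Notation "x * y" := (cmul x y) : line_scope.
Notation "- x" := (copp x) : line_scope.
Notation "\sum_ i F" := (\big[@cadd _/c0]_i F%L) : line_scope.

Local Open Scope line_scope.

Definition cnat (R : cring) (n : nat) : R := iter n (cadd 1) 0.

Section Weil.
Variable R : cring.

Definition coord_mul (B : finType) (c : B -> B -> B -> R)
    (u v : {ffun B -> R}) : {ffun B -> R} :=
  [ffun k => \sum_i \sum_j (u i * v j * c i j k)].

Definition coord_unit (B : finType) (b : B) : {ffun B -> R} :=
  [ffun i => if i == b then 1 else 0].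

(* A commutative R-algebra structure on the free module of functions from a    *)
(* finite basis to R, given by structure constants, whose unit is a basis      *)
(* vector and for which the vectors with zero coordinate along the unit form a *)
(* nilpotent ideal.                                                            *)
Record weil_algebra := WeilAlgebra {
  basis : finType;
  b1 : basis;
  sconst : basis -> basis -> basis -> R;
  weil_mulC : forall u v, coord_mul sconst u v = coord_mul sconst v u;
  weil_mulA : forall u v w,
    coord_mul sconst u (coord_mul sconst v w)
    = coord_mul sconst (coord_mul sconst u v) w;
  weil_mul1 : forall u, coord_mul sconst (coord_unit b1) u = u;
  weil_ideal : forall u v : {ffun basis -> R},
    u b1 = 0 -> coord_mul sconst u v b1 = 0;
  weil_nilpotent : exists q : nat, forall s : 'I_q -> {ffun basis -> R},
    (forall k, s k b1 = 0) ->
    \big[coord_mul sconst/coord_unit b1]_k s k = [ffun=> 0]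
}.

(* The infinitesimal space of a Weil algebra W, i.e. the R-algebra morphisms   *)
(* from W to R.  Such a morphism is determined by its values on the basis, and *)
(* is encoded by them: it sends w to \sum_i w i * x i.                         *)
Definition spec (W : weil_algebra) : Type :=
  {x : {ffun basis W -> R} |
    x (b1 W) = 1 /\ forall i j, x i * x j = \sum_k (sconst i j k * x k)}.

Definition weil_eval (W : weil_algebra) (w : {ffun basis W -> R})
    (x : spec W) : R :=
  \sum_i (w i * sval x i).

(* The canonical morphism of R-algebras from W to the maps spec W -> R is an   *)
(* isomorphism, for every Weil algebra W.                                      *)
Definition kock_lawvere : Prop :=
  forall (W : weil_algebra) (f : spec W -> R),
    exists! w : {ffun basis W -> R}, forall x, f x = weil_eval w x.

(* A finite diagram of infinitesimal spaces, indexed by a finite directed      *)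
(* graph, together with a cocone on it whose apex is an infinitesimal space.   *)
Record inf_cocone := InfCocone {
  vertex : finType;
  edge : finType;
  src : edge -> vertex;
  tgt : edge -> vertex;
  obj : vertex -> weil_algebra;
  arr : forall e, spec (obj (src e)) -> spec (obj (tgt e));
  apex : weil_algebra;
  leg : forall v, spec (obj v) -> spec apex;
  leg_arr : forall e x, leg (arr (e := e) x) = leg x
}.

(* Maps to M turn the cocone into a limit cone. *)
Definition perceives_colimit (M : Type) (C : inf_cocone) : Prop :=
  forall g : (forall v : vertex C, spec (obj v) -> M),
    (forall e x, g _ (arr (i := C) (e := e) x) = g _ x) ->
    exists h : spec (apex C) -> M,
      (forall v x, h (leg (v := v) x) = g v x) /\
      (forall h' : spec (apex C) -> M,
        (forall v x, h' (leg (v := v) x) = g v x) -> forall y, h' y = h y).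

Definition microlinear (M : Type) : Prop :=
  forall C : inf_cocone, perceives_colimit R C -> perceives_colimit M C.

End Weil.

Record line := Line {
  line_ring :> cring;
  natinv : nat -> line_ring;
  natinvP : forall n, 0 < n -> cnat line_ring n * natinv n = 1;
  line_kock_lawvere : kock_lawvere line_ring
}.

Arguments natinv {_} _.

Notation "x / n" := (x * natinv n%N) : line_scope.

Record lie_group (R : line) := LieGroup {
  lie_sort :> Type;
  gone : lie_sort;
  gmul : lie_sort -> lie_sort -> lie_sort;
  ginv : lie_sort -> lie_sort;
  gmulA : forall x y z, gmul x (gmul y z) = gmul (gmul x y) z;
  gmul1l : forall x, gmul gone x = x;
  gmul1r : forall x, gmul x gone = x;
  gmulVl : forall x, gmul (ginv x) x = gone;
  gmulVr : forall x, gmul x (ginv x) = gone;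
  lie_microlinear : microlinear R lie_sort
}.

Arguments gone {_ _}.
Arguments gmul {_ _} _ _.
Arguments ginv {_ _} _.

Bind Scope lie_scope with lie_sort.
Notation "x * y" := (gmul x y) : lie_scope.

Section Infinitesimals.
Variable R : cring.

Definition D : Type := {d : R | d * d = 0}.

Definition D_val (d : D) : R := sval d.

Lemma Dscale_subproof (a : R) (d : D) : (a * sval d) * (a * sval d) = 0.
Proof.
case: d => d dd /=; have [_ _ _ _ mulC mulA _ _ _] := cringP R.
rewrite -mulA (mulC a d) (mulA d d a) dd mulC.
by rewrite !(Rmul_0_l (Eqsth R) (Eq_ext _ _ _) (cringP R)).
Qed.

Definition Dscale (a : R) (d : D) : D := exist _ _ (Dscale_subproof a d).

Lemma Dopp_subproof (d : D) : (- sval d) * (- sval d) = 0.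
Proof.
case: d => d dd /=.
have oppM := Ropp_mul_l (Eqsth R) (Eq_ext _ _ _) (cringP R).
have [_ _ _ _ mulC _ _ _ _] := cringP R.
by rewrite -oppM mulC -oppM dd !(Ropp_opp (Eqsth R) (Eq_ext _ _ _) (cringP R)).
Qed.

Definition Dopp (d : D) : D := exist _ _ (Dopp_subproof d).

End Infinitesimals.

Coercion D_val : D >-> cring_sort.

Section LieTheory.
Variables (R : line) (G : lie_group R).

(* The condition at 0 ranges over all elements of D whose underlying scalar is *)
(* 0, so that no appeal to proof irrelevance is needed.                        *)
Record tangent := Tangent {
  tangent_fun :> D R -> G;
  tangent0 : forall d : D R, D_val d = 0 -> tangent_fun d = gone
}.

Lemma tscale_subproof (a : R) (X : tangent) (d : D R) :
  D_val d = 0 -> X (Dscale a d) = gone.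
Proof.
move=> d0; apply: tangent0; rewrite /D_val /= -/(D_val d) d0.
have [_ _ _ _ mulC _ _ _ _] := cringP R.
by rewrite mulC (Rmul_0_l (Eqsth R) (Eq_ext _ _ _) (cringP R)).
Qed.

Definition tscale (a : R) (X : tangent) : tangent :=
  Tangent (@tscale_subproof a X).

Lemma tadd_subproof (X Y : tangent) (d : D R) :
  D_val d = 0 -> (X d * Y d)%lie = gone.
Proof. by move=> d0; rewrite !tangent0 // gmul1l. Qed.

Definition tadd (X Y : tangent) : tangent := Tangent (@tadd_subproof X Y).

Definition is_lie_bracket (br : tangent -> tangent -> tangent) : Prop :=
  forall (X Y : tangent) (d1 d2 : D R),
    (X d1 * Y d2 * X (Dopp d1) * Y (Dopp d2))%lie = br X Y (Dscale d1 d2).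

Definition regular : Prop :=
  forall s : R -> tangent, exists theta : R -> G,
    theta 0 = gone /\
    forall (t : R) (d : D R), theta (t + d) = (theta t * s t d)%lie.

Definition one_parameter_subgroup (theta : R -> G) : Prop :=
  forall s t : R, theta (s + t) = (theta s * theta t)%lie.

Definition exp_value (X : tangent) (x : G) : Prop :=
  exists theta : R -> G,
    [/\ one_parameter_subgroup theta,
        forall d : D R, theta d = X d
      & x = theta 1].

(* Exponentials exist and are unique, and expo is the resulting function. *)
Definition is_exponential (expo : tangent -> G) : Prop :=
  forall (X : tangent) (x : G), exp_value X x <-> x = expo X.

End LieTheory.

Bind Scope tangent_scope with tangent.
Notation "X + Y" := (tadd X Y) : tangent_scope.
Notation "a *: X" := (tscale a%L X%tan) (at level 40) : tangent_scope.

(* Main.v *)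
From mathcomp Require Import all_boot.
From Stdlib Require Import Ring.
Require Import Defs.

(** Since [exp (t X)] is additive in [t] and equals [X_t] for [t] in [D], the
    left-hand side is the word [X_{d1} Y_{d1} X_{d2} Y_{d2} X_{d3} Y_{d3}], and
    the formula amounts to collecting this word.  For [a], [b] in [D] the
    defining property of the bracket reads
    [Y_b X_a = X_a Y_b [X,Y]_{-ab}].  Factors with nilsquare parameters of
    product [0] commute, so only [[X,[X,Y]]] (once) and [[Y,[X,Y]]] (twice) at [d1 d2 d3]
    survive the second round of commutations, and they are central in the
    subgroup generated by all the elements involved. *)

Set Implicit Arguments.
Unset Strict Implicit.
Unset Printing Implicit Defensive.

Open Scope lie_scope.

Section GroupWords.
Variables (R : line) (G : lie_group R).
Implicit Types x y z : G.

Lemma gmulI x y z : x * y = x * z -> y = z.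
Proof.
by move=> e; rewrite -(gmul1l y) -(gmulVl x) -gmulA e gmulA gmulVl gmul1l.
Qed.

Lemma gmulIr x y z : y * x = z * x -> y = z.
Proof.
by move=> e; rewrite -(gmul1r y) -(gmulVr x) gmulA e -gmulA gmulVr gmul1r.
Qed.

(** Intended values: [xi], [yi] are $X_{d_i}$, $Y_{d_i}$; [uij] is $[X,Y]_{-d_id_j}$; [p], [q] are
    $[X,[X,Y]]$, $[Y,[X,Y]]$ at $d_1d_2d_3$. One [q] arises from moving [u12] past [y3], the other
    from moving [u13] past [y2]. *)
Lemma collect_word (x1 x2 x3 y1 y2 y3 u12 u13 u23 p q : G) :
  y1 * x2 = x2 * y1 * u12 -> y1 * x3 = x3 * y1 * u13 ->
  y2 * x3 = x3 * y2 * u23 ->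
  u12 * x3 = x3 * u12 * p -> u12 * y3 = y3 * u12 * q ->
  u13 * y2 = y2 * u13 * q ->
  u12 * y2 = y2 * u12 -> u13 * y3 = y3 * u13 -> u23 * y3 = y3 * u23 ->
  p * y3 = y3 * p -> q * y3 = y3 * q ->
  q * u12 = u12 * q -> q * u23 = u23 * q -> q * p = p * q ->
  u13 * u12 = u12 * u13 -> u23 * u12 = u12 * u23 ->
  x1 * y1 * (x2 * y2) * (x3 * y3)
  = x1 * x2 * x3 * (y1 * y2 * y3) * (u12 * u13 * u23) * (p * q * q).
Proof.
move=> y1x2 y1x3 y2x3 u12x3 u12y3 u13y2 u12y2 u13y3 u23y3 py3 qy3.
move=> qu12 qu23 qp u13u12 u23u12.
have ext a b c : a * b = c -> forall t, a * (b * t) = c * t :> G.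
  by move=> <- t; rewrite gmulA.
rewrite -!gmulA (ext _ _ _ y1x2) -!gmulA (ext _ _ _ u12y2) -!gmulA.
rewrite (ext _ _ _ u12x3) -!gmulA (ext _ _ _ y2x3) -!gmulA.
rewrite (ext _ _ _ y1x3) -!gmulA (ext _ _ _ u13y2) -!gmulA.
rewrite py3 (ext _ _ _ u12y3) -!gmulA (ext _ _ _ u23y3) -!gmulA.
rewrite (ext _ _ _ qy3) -!gmulA (ext _ _ _ u13y3) -!gmulA.
rewrite (ext _ _ _ u23u12) -!gmulA (ext _ _ _ qu12) -!gmulA.
rewrite (ext _ _ _ u13u12) -!gmulA (ext _ _ _ qu23) -!gmulA.
by rewrite qp (ext _ _ _ qp) -!gmulA.
Qed.

(** Serves $X+2Y$, whose value at [a] is a product [x * (y * y)]: each factor contributes its own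
    commutator with [z], and these collect on the left. *)
Lemma commutator_xyy x y z p q :
  x * z = p * z * x -> y * z = q * z * y ->
  x * q = q * x -> y * q = q * y -> q * p = p * q ->
  x * (y * y) * z = p * q * q * z * (x * (y * y)).
Proof.
move=> xz yz xq yq qp.
have ext a b c : a * b = c -> forall t, a * (b * t) = c * t :> G.
  by move=> <- t; rewrite gmulA.
rewrite -!gmulA yz -!gmulA (ext _ _ _ yq) -!gmulA (ext _ _ _ yz) -!gmulA.
rewrite !(ext _ _ _ xq, =^~ gmulA).
rewrite (ext _ _ _ xz) -!gmulA.
by rewrite (ext _ _ _ qp) -!gmulA (ext _ _ _ qp) -!gmulA.
Qed.

End GroupWords.

Section Exponential.
Variables (R : line) (G : lie_group R).
Variables (bracket : tangent G -> tangent G -> tangent G).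
Variables (expo : tangent G -> G).
Hypothesis Hbracket : is_lie_bracket bracket.
Hypothesis Hexpo : is_exponential expo.
Implicit Types (X Y : tangent G) (s t a b : R).

Add Ring line_ring : (cringP R).

Notation E X t := (expo (t *: X)%tan).

Lemma natinv_eq (n : nat) s t : 0 < n -> s = (cnat R n * t)%L -> (s / n = t)%L.
Proof.
move=> n0 ->; transitivity (cnat R n * natinv n * t)%L; first by ring.
by rewrite natinvP //; ring.
Qed.

(** Squares vanish, so the expansion keeps only the mixed products, each with coefficient 2. *)
Lemma half_square a b c :
  (a * a = 0)%L -> (b * b = 0)%L -> (c * c = 0)%L ->
  ((a + b + c) * (a + b + c) / 2 = a * b + a * c + b * c)%L.
Proof.
by move=> aa bb cc; apply: natinv_eq => //; rewrite /cnat /=; ring [aa bb cc].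
Qed.

(** Only [a * b * c] survives in the cube, with multinomial coefficient 6. *)
Lemma sixth_cube a b c :
  (a * a = 0)%L -> (b * b = 0)%L -> (c * c = 0)%L ->
  ((a + b + c) * (a + b + c) * (a + b + c) / 6 = a * b * c)%L.
Proof.
by move=> aa bb cc; apply: natinv_eq => //; rewrite /cnat /=; ring [aa bb cc].
Qed.

(** If [theta] is the flow of [X], then [u => theta (t * u)] is the flow of [t *: X], and its value
    at 1 is [theta t]. *)
Lemma expo_flow X : exists theta : R -> G,
  [/\ one_parameter_subgroup theta, forall d : D R, theta d = X d
    & forall t, E X t = theta t].
Proof.
have [theta [thetaD thetaX _]] := (Hexpo X (expo X)).2 erefl.
exists theta; split=> // t; symmetry; apply/(Hexpo _ _).
exists (fun u => theta (t * u)%L); split.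
- by move=> u v; rewrite -thetaD; congr theta; ring.
- by move=> d; exact: thetaX (Dscale t d).
- by congr theta; ring.
Qed.

Lemma expoD X s t : E X (s + t) = E X s * E X t.
Proof. by have [theta [thetaD _ e]] := expo_flow X; rewrite !e. Qed.

Lemma expo_D X (d : D R) : E X d = X d.
Proof. by have [theta [_ <- e]] := expo_flow X; rewrite e. Qed.

Lemma expo0 X : E X 0 = gone.
Proof.
apply: (@gmulI _ _ (E X 0)); rewrite -expoD gmul1r.
by congr (E X _); ring.
Qed.

Lemma expoC X s t : E X s * E X t = E X t * E X s.
Proof. by rewrite -!expoD; congr (E X _); ring. Qed.

Lemma expoNl X t : E X (- t) * E X t = gone.
Proof. by rewrite -expoD -(expo0 X); congr (E X _); ring. Qed.

Lemma expo_add X Y a : (a * a = 0)%L -> E (X + Y)%tan a = E X a * E Y a.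
Proof. by move=> aa; rewrite !(expo_D _ (exist _ a aa)). Qed.

Lemma expo_scale X s t : E (s *: X)%tan t = E X (s * t).
Proof.
have [theta [thetaD thetaX e]] := expo_flow X; rewrite e.
symmetry; apply/(Hexpo _ _).
exists (fun u => theta (s * t * u)%L); split.
- by move=> u v; rewrite -thetaD; congr theta; ring.
- move=> d; rewrite /= -thetaX; congr theta.
  by rewrite /D_val /=; ring.
- by congr theta; ring.
Qed.

Lemma expo_commutator X Y a b : (a * a = 0)%L -> (b * b = 0)%L ->
  E X a * E Y b = E (bracket X Y) (a * b) * E Y b * E X a.
Proof.
move=> aa bb; pose da : D R := exist _ a aa; pose db : D R := exist _ b bb.
have := Hbracket X Y da db; rewrite -!expo_D => <-.
rewrite -!gmulA [E Y (- b) * _]gmulA.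
by rewrite expoNl gmul1l expoNl gmul1r.
Qed.

Lemma expo_comm X Y a b :
  (a * a = 0)%L -> (b * b = 0)%L -> (a * b = 0)%L ->
  E X a * E Y b = E Y b * E X a.
Proof.
by move=> aa bb ab; rewrite expo_commutator // ab expo0 gmul1l.
Qed.

(** The bracket factor of [expo_commutator] commutes with the other two, as [a * (a * b)] and
    [b * (a * b)] vanish; so it can change sides, inverted. *)
Lemma expo_swap X Y a b : (a * a = 0)%L -> (b * b = 0)%L ->
  E Y b * E X a = E X a * E Y b * E (bracket X Y) (- (a * b)).
Proof.
move=> aa bb; set Z := bracket X Y.
have sq : (- (a * b) * - (a * b) = 0)%L by ring [aa].
have aab : (a * - (a * b) = 0)%L by ring [aa].
have bab : (b * - (a * b) = 0)%L by ring [bb].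
rewrite -gmulA (expo_comm _ _ bb sq bab) gmulA (expo_comm _ _ aa sq aab).
rewrite -gmulA (expo_commutator X Y aa bb) -/Z -!gmulA gmulA expoNl.
by rewrite gmul1l.
Qed.

Lemma zassenhaus X Y a b c :
  (a * a = 0)%L -> (b * b = 0)%L -> (c * c = 0)%L ->
  let Z := bracket X Y in
  let W := bracket (X + cnat R 2 *: Y)%tan Z in
  E (X + Y)%tan (a + b + c)
  = E X (a + b + c) * E Y (a + b + c) * E Z (- (a * b + a * c + b * c))
    * E W (a * b * c).
Proof.
move=> aa bb cc Z W.
have sq s t : (s * s = 0)%L -> (s * t * (s * t) = 0)%L.
  by move=> ss; ring [ss].
have sqN s t : (s * s = 0)%L -> (- (s * t) * - (s * t) = 0)%L.
  by move=> ss; ring [ss].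
(* The free [u] absorbs normalisation: [- (c * - (a * b))] may be read as [a * b * c]. *)
have swap X' Y' s t u : (s * s = 0)%L -> (t * t = 0)%L ->
    (- (s * t) = u)%L ->
    E Y' t * E X' s = E X' s * E Y' t * E (bracket X' Y') u.
  by move=> ss tt <-; exact: expo_swap.
pose P := bracket X Z; pose Q := bracket Y Z.
(* Bilinearity of the bracket is not invoked: $X+2Y$ at [a] is commuted past [Z] at [b * c], once as
   a whole and once factor by factor, and cancellation identifies the two bracket parts. *)
have WE : E W (a * b * c)
    = E P (a * b * c) * E Q (a * b * c) * E Q (a * b * c).
  have ee : (b * c * (b * c) = 0)%L by exact: sq.
  have XYY : E (X + cnat R 2 *: Y)%tan a = E X a * (E Y a * E Y a).
    rewrite expo_add // expo_scale -expoD.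
    by congr (_ * E Y _); rewrite /cnat /=; ring.
  have eW := expo_commutator (X + cnat R 2 *: Y)%tan Z aa ee.
  rewrite -/W XYY in eW.
  rewrite (_ : a * b * c = a * (b * c))%L; last by ring.
  apply: (gmulIr (x := E Z (b * c) * (E X a * (E Y a * E Y a)))).
  rewrite (gmulA (E W _)) -eW (gmulA (_ * _)); apply: commutator_xyy.
  - exact: expo_commutator.
  - exact: expo_commutator.
  - by apply: expo_comm; try exact: sq; ring [aa].
  - by apply: expo_comm; try exact: sq; ring [aa].
  - by apply: expo_comm; try exact: sq; ring [aa].
rewrite WE !expoD !expo_add //.
rewrite (_ : - (a * b + a * c + b * c) = - (a * b) + - (a * c) + - (b * c))%L;
  last by ring.
rewrite !expoD; apply: collect_word.
all: try by apply: swap => //; try exact: sqN; ring.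
all: try by apply: expo_comm; try exact: sqN; try exact: sq; ring [aa bb cc].
all: exact: expoC.
Qed.

End Exponential.

Theorem theorem35 (R : line) (G : lie_group R)
    (bracket : tangent G -> tangent G -> tangent G)
    (expo : tangent G -> G)
    (Hbracket : is_lie_bracket bracket)
    (Hregular : regular G)
    (Hexpo : is_exponential expo)
    (X Y : tangent G) (d1 d2 d3 : D R) :
  let s : R := (d1 + d2 + d3)%L in
  let Z : tangent G := bracket X Y in
  let W : tangent G := bracket (X + cnat R 2 *: Y)%tan Z in
  expo (s *: (X + Y))%tan
  = expo (s *: X)%tan * expo (s *: Y)%tan
    * expo (- (d1 * d2 + d1 * d3 + d2 * d3) *: Z)%tan
    * expo (d1 * d2 * d3 *: W)%tan
  /\
  expo (s *: X)%tan * expo (s *: Y)%tan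
    * expo (- (d1 * d2 + d1 * d3 + d2 * d3) *: Z)%tan
    * expo (d1 * d2 * d3 *: W)%tan
  = expo (s *: X)%tan * expo (s *: Y)%tan
    * expo (- (s * s / 2) *: Z)%tan
    * expo (s * s * s / 6 *: W)%tan.
Proof.
case: d1 d2 d3 => [a aa] [b bb] [c cc] s Z W; split.
  exact: (zassenhaus Hbracket Hexpo).
by rewrite /s half_square // sixth_cube.
Qed.
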